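(* Let $G$ be a finitely generated group and let $A$ be a vector space over a field $K$. Then every finite-dimensional linear subshift $\Sigma \subset A^G$ is of finite type.
   Context: $A^G$ is the $K$-vector space of all maps $x \colon G \to A$, equipped with the prodiscrete topology (product topology with each factor $A$ discrete) and with the shift action $(gx)(h) = x(g^{-1}h)$. A linear subshift of $A^G$ is a closed $G$-invariant vector subspace of $A^G$. A subset $\Sigma \subset A^G$ is a subshift of finite type if there exist a finite subset $D \subset G$ and a subset $P \subset A^D$ such that $\Sigma = \{x \in A^G : (g^{-1}x)|_D \in P \text{ for all } g \in G\}$. The space $A$ is not assumed finite-dimensional. *)

(* Defs.v *)
From HB Require Import structures.
From mathcomp Require Import all_boot all_algebra.
From mathcomp Require Import all_classical all_reals all_analysis.

Set Implicit Arguments.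
Unset Strict Implicit.
Unset Printing Implicit Defensive.

Import GRing.Theory.

Local Open Scope classical_set_scope.

Definition is_subgroup (G : groupType) (H : set G) : Prop :=
  group_closed [in H].

Definition finitely_generated (G : groupType) : Prop :=
  exists2 S : set G, finite_set S & smallest (@is_subgroup G) S = setT.

Definition is_vector_subspace (K : fieldType) (V : lmodType K) (S : set V) :
  Prop := GRing.submod_closed [in S].

Definition finite_dimensional (K : fieldType) (V : lmodType K) (S : set V) :
  Prop :=
  exists (n : nat) (b : 'I_n -> V),
    S = range (fun c : 'I_n -> K => \sum_(i < n) c i *: b i)%R.

Definition shift_action (G : groupType) (A : Type) (g : G) (x : G -> A) :
  G -> A :=
  fun h => x (g^-1 * h)%g.

Definition shift_invariant (G : groupType) (A : Type) (Sigma : set (G -> A)) :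
  Prop := forall (g : G) (x : G -> A), Sigma x -> Sigma (shift_action g x).

Definition prodiscrete_closed (G : Type) (A : choiceType) (X : set (G -> A)) :
  Prop := closed (X : set {ptws G -> discrete_topology A}).

Definition linear_subshift (K : fieldType) (G : groupType) (A : lmodType K)
    (Sigma : set (G -> A)) : Prop :=
  [/\ prodiscrete_closed Sigma, shift_invariant Sigma
    & is_vector_subspace Sigma].

(* sigL D y is the restriction of y to D. *)
Definition subshift_of_finite_type (G : groupType) (A : Type)
    (Sigma : set (G -> A)) : Prop :=
  exists (D : set G) (P : set (D -> A)), finite_set D /\
    Sigma = [set x | forall g : G, P (sigL D (shift_action g^-1%g x))].

(* Main.v *)
(** Finite dimension yields a finite window [E] on which a configuration of
    [Sigma] determines the whole configuration. Take [D] to contain [1], [E] and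
    all [s E] with [s] a generator. If every translate of [x] agrees on [D] with
    an element of [Sigma], let [z g] in [Sigma] agree with [x] on [g D]. Since
    [g s E] lies in both [g D] and [g s D], we get [z g = z (g s)]; hence [z] is
    constant and equal to [x]. *)

Require Import Defs.
From mathcomp Require Import all_boot all_algebra.
From mathcomp Require Import all_classical all_reals all_analysis.

Set Implicit Arguments.
Unset Strict Implicit.
Unset Printing Implicit Defensive.

Import GRing.Theory.

Local Open Scope classical_set_scope.
Local Open Scope ring_scope.

(* If the first [n] vectors are separated by [E] but the whole family is not,
   then the combinations vanishing on [E] form a line, and one further point,
   where a generator of that line is nonzero, suffices. *)
Lemma separating_seq (K : fieldType) (T : choiceType) (A : lmodType K)
    (n : nat) (b : 'I_n -> T -> A) :
  exists E : seq T, forall c : 'I_n -> K,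
    {in E, forall t, (\sum_(i < n) c i *: b i) t = 0} ->
    \sum_(i < n) c i *: b i = 0.
Proof.
elim: n b => [|n IHn] b; first by exists [::] => c _; rewrite big_ord0.
have [E sepE] := IHn (fun i => b (widen_ord (leqnSn n) i)).
have [[c [c_E /eqP c_neq0]]|sepEb] := pselect (exists c : 'I_n.+1 -> K,
    {in E, forall t, (\sum_i c i *: b i) t = 0} /\ \sum_i c i *: b i <> 0);
  last first.
  by exists E => c c_E; apply: contrapT => c_neq0; apply: sepEb; exists c.
(* Otherwise only the first [n] vectors would occur, and [sepE] would force the combination to be
   zero. *)
have cmax_neq0 : c ord_max != 0.
  apply: contra c_neq0 => /eqP cmax0; apply/eqP.
  move: c_E; rewrite big_ord_recr /= cmax0 scale0r addr0.
  exact: (sepE (fun i => c (widen_ord _ i))).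
have [t0 t0P] : exists t0, (\sum_i c i *: b i) t0 <> 0.
  apply: contrapT => /forallNP no_t; move/eqP: c_neq0; apply.
  by apply/funext => t; apply: contrapT (no_t t).
exists (t0 :: E) => d d_E.
(* With this ratio [d - r * c] has last coefficient zero, which brings the difference under
   [sepE]. *)
set r := d ord_max / c ord_max.
have d_line : \sum_i d i *: b i = r *: \sum_i c i *: b i.
  apply/eqP; rewrite -subr_eq0; apply/eqP.
  have subE : \sum_i d i *: b i - r *: \sum_i c i *: b i =
      \sum_(i < n) (d (widen_ord (leqnSn n) i) - r * c (widen_ord (leqnSn n) i))
        *: b (widen_ord (leqnSn n) i).
    rewrite scaler_sumr -sumrB big_ord_recr /= scalerA divfK // subrr addr0.
    by apply: eq_bigr => i _; rewrite scalerBl scalerA.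
  rewrite subE; apply: sepE => t tE; rewrite -subE.
  have -> : (\sum_i d i *: b i - r *: \sum_i c i *: b i) t =
    (\sum_i d i *: b i) t - r *: (\sum_i c i *: b i) t by [].
  by rewrite c_E // d_E ?inE ?tE ?orbT // scaler0 subrr.
have : r *: (\sum_i c i *: b i) t0 = 0.
  by rewrite -[LHS]/((r *: \sum_i c i *: b i) t0) -d_line d_E ?mem_head.
move/eqP; rewrite scaler_eq0 => /orP[/eqP r0|/eqP//].
by rewrite d_line r0 scale0r.
Qed.

(** The difference of two elements is again a combination of the [b i], and it vanishes on [E]. *)
Lemma finite_dimensional_determined (K : fieldType) (T : choiceType)
    (A : lmodType K) (S : set (T -> A)) :
  finite_dimensional S ->
  exists E : seq T, forall x y, S x -> S y -> {in E, x =1 y} -> x = y.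
Proof.
move=> [n [b ->]]; have [E sepE] := separating_seq b.
exists E => _ _ [c _ <-] [d _ <-] cd_E.
apply/eqP; rewrite -subr_eq0 -sumrB; apply/eqP.
have subE : \sum_(i < n) (c i *: b i - d i *: b i) =
    \sum_(i < n) (c i - d i) *: b i.
  by apply: eq_bigr => i _; rewrite scalerBl.
rewrite subE; apply: sepE => t tE; rewrite -subE sumrB.
by apply/eqP; rewrite subr_eq0; apply/eqP; exact: cd_E.
Qed.

Section ShiftAction.
Local Open Scope group_scope.

Lemma shift_actionK (G : groupType) (A : Type) (g : G) :
  cancel (@shift_action G A g) (shift_action g^-1).
Proof. by move=> x; apply/funext => h; rewrite /shift_action invgK mulKg. Qed.

(** Shifting by [g^-1] stays in [Sigma] and carries the window [g E] back to [E]. *)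
Lemma shift_invariant_determined (G : groupType) (A : Type)
    (Sigma : set (G -> A)) (E : seq G) (g : G) :
  shift_invariant Sigma ->
  (forall x y, Sigma x -> Sigma y -> {in E, x =1 y} -> x = y) ->
  forall x y, Sigma x -> Sigma y ->
    {in E, forall e, x (g * e) = y (g * e)} -> x = y.
Proof.
move=> invS detE x y Sx Sy xy; apply: (can_inj (shift_actionK g^-1)).
apply: detE; [exact: invS | exact: invS |].
by move=> e eE; rewrite /shift_action invgK xy.
Qed.

(** The right periods of [f] form a subgroup containing [S]. *)
Lemma right_invariant_constant (G : groupType) (A : Type)
    (S : set G) (f : G -> A) :
  smallest (@is_subgroup G) S = setT ->
  (forall g s, S s -> f (g * s) = f g) -> forall g, f g = f 1.
Proof.
move=> genS fS g; pose H := [set h | forall g', f (g' * h) = f g'].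
suff Hg : H g by rewrite -[in LHS](mul1g g) Hg.
suff : smallest (@is_subgroup G) S `<=` H by apply; rewrite genS.
apply: smallest_sub => [|s Ss g']; last exact: fS.
split; first by apply: mem_set => g'; rewrite mulg1.
move=> h k /set_mem Hh /set_mem Hk; apply: mem_set => g'.
by rewrite -Hk mulgA mulgVK Hh.
Qed.

End ShiftAction.

Theorem proposition2p4 (K : fieldType) (G : groupType) (A : lmodType K)
  (Sigma : set (G -> A)) :
  finitely_generated G ->
  linear_subshift Sigma ->
  finite_dimensional Sigma ->
  subshift_of_finite_type Sigma.
Proof.
move=> [S /finite_seqP[s ->] genS] [_ invS _].
move=> /finite_dimensional_determined[E detE].
pose D := 1%g :: E ++ [seq (t * e)%g | t <- s, e <- E].
(* The allowed patterns are the restrictions to [D] of elements of [Sigma]. *)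
exists [set` D], (sigL [set` D] @` Sigma); split; first exact: finite_seq.
apply/seteqP; split => [x Sx g|x xP].
  by exists (shift_action g^-1 x) => //; exact: invS.
have {}xP g : exists z, Sigma z /\ {in D, forall h, z (g * h)%g = x (g * h)%g}.
  have [y Sy /eq_sigLP yx] := xP g.
  exists (shift_action g y); split; first exact: invS.
  by move=> h hD; rewrite /shift_action mulKg yx ?inE // /shift_action invgK.
have [z zP] := choice xP.
have z_const g : z g = z 1%g.
  apply: (right_invariant_constant genS) => {}g t /= ts.
  apply: (shift_invariant_determined (g := (g * t)%g) invS detE).
  - exact: (zP _).1.
  - exact: (zP _).1.
  (* The same point is [(g * t) * e] with [e] in [D] for [z (g * t)], and [g * (t * e)] with [t * e]
     in [D] for [z g]. *)
  move=> e eE; rewrite (zP _).2 ?inE ?mem_cat ?eE ?orbT //.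
  rewrite -mulgA (zP _).2 // inE mem_cat.
  by rewrite (allpairs_f (fun t e => (t * e)%g)) ?orbT.
suff -> : x = z 1%g by exact: (zP _).1.
apply/funext => g; rewrite -(z_const g).
(* Since [1] lies in [D], [z g] agrees with [x] at [g] itself. *)
by have := (zP g).2 1%g; rewrite mulg1 => -> //; exact: mem_head.
Qed.
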